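(* If $X$ is a nonempty finite set of size $n$, then the largest subsemilattices (subsemilattices of maximum cardinality) of $P(X)$ have $2^{n}$ elements.
   Context: $P(X)$ is the monoid of all partial transformations on $X$, i.e. all maps from a subset of $X$ to $X$, under composition of partial maps. A semilattice is a commutative semigroup all of whose elements are idempotent; a subsemilattice of a monoid is a subsemigroup that is a semilattice. *)

(* Defs.v *)
From HB Require Import structures.
From mathcomp Require Import all_boot monoid.

Set Implicit Arguments.
Unset Strict Implicit.
Unset Printing Implicit Defensive.

Import Algebra.
Local Open Scope group_scope.

(* P(X): f x = None means that x lies outside the domain of f. *)
Definition ptransf (X : finType) : predArgType := {ffun X -> option X}.

HB.instance Definition _ (X : finType) := Finite.on (ptransf X).

(* Maps act on the left: f * g applies g first and then f. *)
Definition ptransf_mul (X : finType) (f g : ptransf X) : ptransf X :=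
  [ffun x => pcomp f g x].

Definition ptransf_one (X : finType) : ptransf X := [ffun x => Some x].

Lemma ptransf_mulA (X : finType) : associative (@ptransf_mul X).
Proof.
move=> f g h; apply/ffunP => x; rewrite !ffunE /pcomp.
by rewrite !ffunE /pcomp; case: (h x) => //= y; rewrite ffunE.
Qed.

Lemma ptransf_one_mul (X : finType) :
  left_id (ptransf_one X) (@ptransf_mul X).
Proof.
by move=> f; apply/ffunP => x; rewrite ffunE /pcomp; case: (f x) => //= y;
  rewrite ffunE.
Qed.

Lemma ptransf_mul_one (X : finType) :
  right_id (ptransf_one X) (@ptransf_mul X).
Proof. by move=> f; apply/ffunP => x; rewrite ffunE /pcomp ffunE. Qed.

HB.instance Definition _ (X : finType) :=
  isMonoid.Build (ptransf X)
    (@ptransf_mulA X) (@ptransf_one_mul X) (@ptransf_mul_one X).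

Definition subsemilattice (M : monoidType) (S : {pred M}) : Prop :=
  [/\ mulg_closed S,
      {in S &, forall f g, commute f g} &
      {in S, forall f, f * f = f}].

Definition largest_subsemilattice (X : finType) (S : {set ptransf X}) : Prop :=
  subsemilattice S /\
  forall T : {set ptransf X}, subsemilattice T -> #|T| <= #|S|.

(* Main.v *)
Require Import Defs.
From mathcomp Require Import all_boot.
From mathcomp Require Import monoid.

(** An idempotent partial transformation fixes every point of its image. Hence if [f] and [g] are
    idempotents with the same fixed points, then [f g = g] and [g f = f]; if they also commute,
    they are equal. So in a subsemilattice of [P(X)] an element is determined by its set of fixed
    points, a subset of [X]; the partial identities realise all [2 ^ n] subsets. *)

Definition fixed_points (X : finType) (f : ptransf X) : {set X} :=
  [set x | f x == Some x].

Definition partial_id (X : finType) (A : {set X}) : ptransf X :=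
  [ffun x => if x \in A then Some x else None].

Lemma idempotent_fixes_image (X : finType) (f : ptransf X) (x y : X) :
  (f * f)%g = f -> f x = Some y -> y \in fixed_points X f.
Proof.
move=> ff fx; have := congr1 (fun h : ptransf X => h x) ff.
by rewrite ffunE /pcomp fx /= inE => ->.
Qed.

(** Every value of [g] is fixed by [g], hence by [f]; where [g] is undefined, so is [f * g]. *)
Lemma mul_fixed_points_sub (X : finType) (f g : ptransf X) :
  (g * g)%g = g -> fixed_points X g \subset fixed_points X f -> (f * g)%g = g.
Proof.
move=> gg /subsetP sgf; apply/ffunP => x; rewrite ffunE /pcomp.
case gx: (g x) => [y|] //=.
by have := sgf _ (idempotent_fixes_image X g x y gg gx); rewrite inE => /eqP.
Qed.

Lemma fixed_points_inj (X : finType) (S : {set ptransf X}) :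
  subsemilattice S -> {in S &, injective (fixed_points X)}.
Proof.
case=> _ comm idem f g fS gS eq_fix.
(* Here [g] is replaced by [f * g], which then commutes to [g * f] and collapses to [f]. *)
rewrite -(mul_fixed_points_sub X f g) ?idem ?eq_fix //.
by rewrite comm // mul_fixed_points_sub ?idem ?eq_fix.
Qed.

Lemma card_subsemilattice (X : finType) (S : {set ptransf X}) :
  subsemilattice S -> #|S| <= 2 ^ #|X|.
Proof.
move=> sS; rewrite -(card_in_imset (fixed_points_inj X S sS)).
by rewrite -cardsT -card_powerset subset_leq_card // powersetT subsetT.
Qed.

(** Reduces the semilattice laws for partial identities to those of intersection. *)
Lemma partial_idM (X : finType) (A B : {set X}) :
  (partial_id X A * partial_id X B)%g = partial_id X (A :&: B).
Proof.
apply/ffunP => x; rewrite !ffunE /pcomp ffunE inE.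
by case: (x \in B); rewrite ?andbF //= ffunE andbT.
Qed.

(** Makes [partial_id] injective, so that partial identities are counted by subsets. *)
Lemma fixed_points_partial_id (X : finType) :
  cancel (partial_id X) (fixed_points X).
Proof.
by move=> A; apply/setP => x; rewrite inE ffunE; case: (x \in A); rewrite ?eqxx.
Qed.

Definition partial_ids (X : finType) : {set ptransf X} :=
  [set partial_id X A | A : {set X}].

Lemma partial_ids_subsemilattice (X : finType) : subsemilattice (partial_ids X).
Proof.
split=> [_ _ /imsetP[A _ ->] /imsetP[B _ ->]|
         _ _ /imsetP[A _ ->] /imsetP[B _ ->]|_ /imsetP[A _ ->]].
- by rewrite partial_idM imset_f.
- by rewrite /commute !partial_idM setIC.
- by rewrite partial_idM setIid.
Qed.

Lemma card_partial_ids (X : finType) : #|partial_ids X| = 2 ^ #|X|.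
Proof.
rewrite card_imset; last exact: can_inj (fixed_points_partial_id X).
by rewrite -[LHS]cardsT -powersetT card_powerset cardsT.
Qed.

Theorem corollary1p4 (X : finType) (n : nat) (cardX : #|X| = n) (n_gt0 : 0 < n) :
  (exists S : {set ptransf X}, largest_subsemilattice S) /\
  (forall S : {set ptransf X}, largest_subsemilattice S -> #|S| = 2 ^ n).
Proof.
rewrite -cardX; split.
  exists (partial_ids X); split=> [|T sT]; first exact: partial_ids_subsemilattice.
  by rewrite card_partial_ids card_subsemilattice.
move=> S [sS maxS]; apply/eqP; rewrite eqn_leq card_subsemilattice //=.
(* The lower bound comes from comparing [S] with the partial identities. *)
by rewrite -card_partial_ids maxS //; exact: partial_ids_subsemilattice.
Qed.
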